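(* Let $F$ be a closed relation on a compact metric space $X$, and assume that the closed set $C\subset X$ is an isolating neighborhood for a viable set $A$ (that is, $A = C_{\pm}\subset C^{\circ}$). (a) If $(P_1,P_2)$ is an index pair rel $C$ for $A$, then $P_1$ and $P_2$ are $\mathcal{C}(F_C)$ + invariant sets with $C_- \subset P_1$ and $C_+ \cap P_2 = \emptyset$. In addition, $C \cap \rho_F(P_1) = \delta_F(P_1) \subset P_1 \cap \partial C \subset P_2$. (b) If $U$ and $V$ are open subsets of $X$ with $C_- \subset U$ and $C_{\pm} \subset V \subset C$, then there exist a simple isolating neighborhood $C_0$ and an index pair $(P_1,P_2)$ rel $C$ for $A$ with $P_1 \subset U$ and $\overline{P_1 \setminus P_2} \subset C_0 \subset V$. In particular, $\overline{P_1\setminus P_2}\subset C^{\circ}$.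
   Context: A relation $F$ on $X$ is a subset of $X\times X$, closed if it is a closed subset; $F(x)=\{y:(x,y)\in F\}$, $F(A)=\bigcup_{x\in A}F(x)$, $F^{-1}=\{(y,x):(x,y)\in F\}$; $F^n$ is the $n$-fold composition, $F^{-n}=(F^{-1})^n$. A set $P$ is + invariant for a relation $R$ if $R(P)\subset P$. $A^\circ$ and $\overline A$ are interior and closure in $X$, and $\partial C=C\setminus C^\circ$ for closed $C$. For closed $C$: $F_C=F\cap(C\times C)$; $C_-=\bigcap_{n\ge1}(F_C)^n(C)$, $C_+=\bigcap_{n\ge1}(F_C)^{-n}(C)$, $C_\pm=C_+\cap C_-$. A closed set $A$ is viable for $F$ if $A \subset F(A)\cap F^{-1}(A)$, equivalently through every point of $A$ passes a bi-infinite sequence $(x_n)_{n\in\mathbb{Z}}$ in $A$ with $x_{n+1}\in F(x_n)$; $C_\pm$ is the maximum viable subset of $C$. $C$ is an isolating neighborhood (for $C_\pm$) if $C_\pm\subset C^\circ$. $C$ is a simple isolating neighborhood if for every $x\in\partial C$ either $F(x)\cap C=\emptyset$ or $F^{-1}(x)\cap C=\emptyset$. $\rho_F(P)=\overline{F(P)\setminus P}$ and $\delta_F(P)=P\cap\rho_F(P)$. For a relation $R$ on $X$: $\mathcal{O}R=\bigcup_{n\ge1}R^n$, $V_\epsilon=\{(x,y):d(x,y)<\epsilon\}$, and the chain relation is $\mathcal{C}R=\bigcap_{\epsilon>0}\mathcal{O}(V_\epsilon\circ R)$. An index pair rel $C$ for $A$ ($C$ an isolating neighborhood for $A=C_\pm$)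 is a pair $(P_1,P_2)$ of closed subsets of $X$ with: (i) $P_2\subset P_1\subset C$; (ii) $P_1$ and $P_2$ are $F_C$ + invariant; (iii) $A=C_\pm\subset P_1^\circ\setminus P_2$; (iv) $P_1\setminus P_2\subset C^\circ$. *)

(* Defs.v *)
From mathcomp Require Import all_boot all_order all_algebra.
From mathcomp Require Import all_classical all_reals all_analysis.

Set Implicit Arguments.
Unset Strict Implicit.
Unset Printing Implicit Defensive.

Import Order.TTheory GRing.Theory Num.Theory.

Local Open Scope classical_set_scope.
Local Open Scope ring_scope.

(* A relation on X is a [set (X * X)].  Beware that the library notation
   [(G \; F)%relation] means "first F, then G", i.e. G o F, that
   [(F^-1)%relation] is the converse relation, and that [xsection F x] is
   F(x). *)

Section Relations.
Context {X : Type}.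
Implicit Types (F R : set (X * X)) (A P C : set X).

Definition rel_image F A : set X := \bigcup_(x in A) xsection F x.

Definition rel_iter F (n : nat) : set (X * X) :=
  iter n (fun G => (F \; G)%relation) diagonal.

Definition pos_invariant R P : Prop := rel_image R P `<=` P.

Definition rel_restr F C : set (X * X) := F `&` (C `*` C).

(* C_-, C_+ and C_\pm *)
Definition inv_minus F C : set X :=
  \bigcap_(n in [set n | (1 <= n)%N]) rel_image (rel_iter (rel_restr F C) n) C.

Definition inv_plus F C : set X :=
  \bigcap_(n in [set n | (1 <= n)%N])
    rel_image (rel_iter ((rel_restr F C)^-1)%relation n) C.

Definition inv_pm F C : set X := inv_plus F C `&` inv_minus F C.

(* the orbit relation \mathcal{O}R *)
Definition orbit_rel R : set (X * X) :=
  \bigcup_(n in [set n | (1 <= n)%N]) rel_iter R n.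

End Relations.

Section TopologicalRelations.
Context {X : topologicalType}.
Implicit Types (F : set (X * X)) (A P C : set X).

(* only meant for closed sets *)
Definition boundary C : set X := C `\` C°.

Definition viable F A : Prop :=
  closed A /\
  A `<=` rel_image F A `&` rel_image (F^-1)%relation A.

Definition isolating_nbhd F C A : Prop :=
  [/\ closed C, A = inv_pm F C & inv_pm F C `<=` C°].

Definition simple_isolating_nbhd F C : Prop :=
  closed C /\
  forall x, boundary C x ->
    xsection F x `&` C = set0 \/ xsection (F^-1)%relation x `&` C = set0.

Definition rho F P : set X := closure (rel_image F P `\` P).

Definition delta F P : set X := P `&` rho F P.

Definition index_pair F C A P1 P2 : Prop :=
  isolating_nbhd F C A /\
  [/\ closed P1 /\ closed P2,
      P2 `<=` P1 /\ P1 `<=` C,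
      pos_invariant (rel_restr F C) P1 /\ pos_invariant (rel_restr F C) P2,
      A `<=` P1° `\` P2
    & P1 `\` P2 `<=` C°].

End TopologicalRelations.

Section ChainRelation.
Context {K : realType} {X : metricType K}.

Definition V_ (e : K) : set (X * X) := [set xy | mdist xy.1 xy.2 < e].

(* the chain relation \mathcal{C}R *)
Definition chain_rel (R : set (X * X)) : set (X * X) :=
  \bigcap_(e in [set e : K | 0 < e]) orbit_rel (V_ e \; R)%relation.

End ChainRelation.

(* Main.v *)
Require Import Defs.
From mathcomp Require Import all_boot all_order all_algebra.
From mathcomp Require Import all_classical all_reals all_analysis.

Set Implicit Arguments.
Unset Strict Implicit.
Unset Printing Implicit Defensive.

Import Order.TTheory GRing.Theory Num.Theory.

(** Write f for F_C.  Its image lies in C, so C_- is the intersection of all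
    f^n(X) and C_+ the intersection of all f^(-n)(X); below these are the
    [eventual_image]s of f and of its converse.  Everything rests on one
    compactness principle: a decreasing sequence of closed sets whose
    intersection lies in an open set U is eventually inside U
    ([nested_closed_subset]).  It shows that iterated images pass to the limit
    along a decreasing sequence of closed relations H_k with intersection inside
    f ([approx_iter_image]), even when the number of iterations grows with k
    ([approx_eventual_image]).

    For (a), f^n(X) and f^(-n)(X) meet only near A when n is large.  A point of
    C_- has a backward orbit of length 2n, whose midpoint is therefore in the
    interior of P1, and + invariance brings that point into P1; symmetrically,
    the forward orbit of a point of C_+ in P2 would meet a neighborhood of A
    disjoint from P2.  If (x, y) is in the chain relation, the eps-chains from x
    to y either have bounded length along a sequence eps -> 0, and then y is on
    a genuine f-orbit of x, or have unbounded length, and then x is in C_+ and y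
    is in C_- ([approx_orbit]).  In the first case + invariance suffices; in the
    second, y is in P1 because C_- is contained in P1, and x is not in P2.

    For (b), let Q_k be the k-th iterated image of X under the closure of
    V_(1/(k+1)) o f.  These closed sets decrease to a subset of C_-, and f maps
    Q_k into its interior.  Let R_k be the analogous sets for the converse of f.
    For k large, Q_k is inside U and C0 = Q_k /\ R_k is inside V.  As f and its
    converse push Q_k and R_k strictly inside, a boundary point of C0 either
    has no F-preimage in C0 (if it is on the boundary of Q_k) or no F-image in
    C0 (if it is on the boundary of R_k), so C0 is simple.  The index pair is
    P1 = Q_k /\ C and P2 = P1 \ int R_k: a point of P2 cannot be mapped into
    R_k, as it would then be in int R_k. *)

Local Open Scope classical_set_scope.
Local Open Scope ring_scope.

(** * Iterated relations and images *)

Section IteratedImages.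
Context {X : Type}.
Implicit Types (R H : set (X * X)) (A C P S : set X) (x y z : X).

Lemma rel_imageP R S y : rel_image R S y <-> exists2 x, S x & R (x, y).
Proof.
by split=> [[x Sx /xsectionP Rxy]|[x Sx Rxy]]; exists x => //; apply/xsectionP.
Qed.

Lemma rel_imageS R R' S S' :
  R `<=` R' -> S `<=` S' -> rel_image R S `<=` rel_image R' S'.
Proof.
move=> RR' SS' y /rel_imageP[x Sx Rxy]; apply/rel_imageP.
by exists x; [exact: SS' | exact: RR'].
Qed.

Lemma rel_iterD R m n x y : rel_iter R (m + n) (x, y) <->
  exists2 z, rel_iter R m (x, z) & rel_iter R n (z, y).
Proof.
elim: n y => [|n IHn] y.
  rewrite addn0; split=> [Rxy|[z Rxz]]; first by exists y.
  by rewrite /rel_iter /= => /diagonalP <-.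
rewrite addnS; split=> [[w /= /IHn[z Rxz Rzw] Rwy]|[z Rxz [w /= Rzw Rwy]]].
  by exists z => //; exists w.
by exists w => //=; apply/IHn; exists z.
Qed.

Lemma rel_iter1 R x y : rel_iter R 1 (x, y) <-> R (x, y).
Proof.
by split=> [[z /= /diagonalP <-]|Rxy] //; exists x.
Qed.

Lemma rel_iter_conv R n x y :
  rel_iter (R^-1)%relation n (x, y) <-> rel_iter R n (y, x).
Proof.
elim: n x y => [|n IHn] x y.
  by split=> /diagonalP ->.
split.
  move=> [z /= /IHn Rzx Ryz]; apply/(rel_iterD R 1 n); exists z => //.
  exact/rel_iter1.
by move=> /(rel_iterD R 1 n)[z /rel_iter1 Ryz Rzx]; exists z => //=; apply/IHn.
Qed.

Lemma rel_iterS R R' n : R `<=` R' -> rel_iter R n `<=` rel_iter R' n.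
Proof.
move=> RR'; elim: n => [|n IHn] [x y] //= [z /= Rxz Rzy].
by exists z => /=; [exact: IHn | exact: RR'].
Qed.

Lemma rel_image_iter R n S :
  rel_image (rel_iter R n) S = iter n (rel_image R) S.
Proof.
elim: n => [|n IHn] /=.
  apply/seteqP; split=> [y /rel_imageP[x Sx /diagonalP <-]//|y Sy].
  by apply/rel_imageP; exists y.
rewrite -IHn; apply/seteqP; split=> y /rel_imageP[x].
  move=> Sx [z /= Rxz Rzy]; apply/rel_imageP; exists z => //.
  by apply/rel_imageP; exists x.
by move=> /rel_imageP[w Sw Rwx] Rxy; apply/rel_imageP; exists w => //; exists x.
Qed.

Lemma iter_imageS R R' n S S' : R `<=` R' -> S `<=` S' ->
  iter n (rel_image R) S `<=` iter n (rel_image R') S'.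
Proof. by move=> RR' SS'; elim: n => //= n IHn; apply: rel_imageS. Qed.

Lemma iter_image_setT R m n : (m <= n)%N ->
  iter n (rel_image R) setT `<=` iter m (rel_image R) setT.
Proof.
by move=> /subnKC <-; rewrite iterD; exact: iter_imageS.
Qed.

Lemma iter_image_setTP R n y :
  iter n (rel_image R) setT y <-> exists x, rel_iter R n (x, y).
Proof.
rewrite -rel_image_iter; split=> [/rel_imageP[x _ Rxy]|[x Rxy]]; first by exists x.
by apply/rel_imageP; exists x.
Qed.

Lemma pos_invariant_iter R P n x y :
  pos_invariant R P -> P x -> rel_iter R n (x, y) -> P y.
Proof.
move=> PR Px; elim: n y => [|n IHn] y; first by move=> /diagonalP <-.
by move=> [z /= /IHn Pz Rzy]; apply/PR/rel_imageP; exists z.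
Qed.

(** In a compact space and for closed [R], the points at which an infinite
    backward [R]-orbit ends. *)
Definition eventual_image R : set X :=
  \bigcap_n iter n (rel_image R) setT.

Lemma eventual_image_restr R C : R `<=` C `*` C ->
  \bigcap_(n in [set n | (1 <= n)%N]) rel_image (rel_iter R n) C
  = eventual_image R.
Proof.
move=> RC; apply/seteqP; split=> y yR n _.
  have yn := yR n.+1 (ltn0Sn n).
  apply: (iter_image_setT (leqnSn n)).
  by rewrite rel_image_iter in yn; exact: iter_imageS yn.
rewrite rel_image_iter; have := yR n.+1 I; rewrite iterSr.
by apply: iter_imageS => // z /rel_imageP[x _ /RC[]].
Qed.

Lemma inv_minusE F C : inv_minus F C = eventual_image (rel_restr F C).
Proof. by apply: eventual_image_restr => -[x y] []. Qed.

Lemma inv_plusE F C :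
  inv_plus F C = eventual_image ((rel_restr F C)^-1)%relation.
Proof. by apply: eventual_image_restr => -[x y] [_ [/= Cy Cx]]. Qed.

End IteratedImages.

(** * Closed relations on a compact space *)

Section CompactSpace.
Context {X : topologicalType}.
Hypotheses (X_compact : compact [set: X]) (X_hausdorff : hausdorff_space X).
Implicit Types (R : set (X * X)) (S P U : set X) (x y : X).

Lemma nested_closed_subset (Q : nat -> set X) U : (forall n, closed (Q n)) ->
  (forall m n, (m <= n)%N -> Q n `<=` Q m) -> open U ->
  \bigcap_n Q n `<=` U -> exists n, forall m, (n <= m)%N -> Q m `<=` U.
Proof.
move=> Qcl Qdec Uop QU.
have /compact_near_coveringP/(_ nat \oo (fun n => [set x | Q n x -> U x])) :=
  X_compact.
case=> [x _|n _ nU].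
  have [Ux|nUx] := pselect (U x).
    near=> y n => /= _; near: y; exact: open_nbhs_nbhs.
  have [m nQx] : exists m, ~ Q m x.
    by apply/existsNP => Qx; apply/nUx/QU => n _.
  near=> y n => /= Qny; exfalso.
  have : ~ Q m y.
    near: y; apply: (@open_nbhs_nbhs _ x (~` Q m)); split => //.
    exact: closed_openC.
  by apply; apply: Qdec Qny; near: n; exact: nbhs_infty_ge.
by exists n => m nm x; exact: (nU m nm x I).
Unshelve. all: by end_near. Qed.

Lemma nested_closed_nonempty (Q : nat -> set X) : (forall n, closed (Q n)) ->
  (forall m n, (m <= n)%N -> Q n `<=` Q m) ->
  (forall n, Q n !=set0) -> \bigcap_n Q n !=set0.
Proof.
move=> Qcl Qdec Qn0; apply: contrapT => /set0P/negP/negPn/eqP Q0.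
have [|n nQ] := @nested_closed_subset Q set0 Qcl Qdec open0.
  by rewrite Q0.
by have [x /nQ] := Qn0 n; apply.
Qed.

Lemma closed_fst_preimage S : closed S -> closed (@fst X X @^-1` S).
Proof. by apply: preimage_closed => x _; exact: cvg_fst. Qed.

Lemma closed_snd_preimage S : closed S -> closed (@snd X X @^-1` S).
Proof. by apply: preimage_closed => x _; exact: cvg_snd. Qed.

Lemma closed_converse R : closed R -> closed (R^-1)%relation.
Proof.
apply: (@preimage_closed _ _ (fun xy : X * X => (xy.2, xy.1))) => x _.
by apply: cvg_pair; [exact: cvg_snd | exact: cvg_fst].
Qed.

Lemma closed_rel_image R S : closed R -> closed S -> closed (rel_image R S).
Proof.
move=> Rcl Scl.
have -> : rel_image R S = snd @` (R `&` (@fst X X @^-1` S)).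
  apply/seteqP; split=> [y /rel_imageP[x Sx Rxy]|_ [[x y] [Rxy Sx] <-]].
    by exists (x, y).
  by apply/rel_imageP; exists x.
apply: compact_closed => //; apply: continuous_compact.
  by apply: continuous_subspaceT => x; exact: cvg_snd.
have /subclosed_compact : compact [set: X * X].
  by rewrite -setXTT; exact: compact_setX.
apply=> //; apply: closedI => //; exact: closed_fst_preimage.
Qed.

Lemma closed_xsection R x : closed R -> closed (xsection R x).
Proof.
move=> Rcl; rewrite xsectionE; apply: preimage_closed => // y _.
by apply: cvg_pair; [exact: cvg_cst | exact: cvg_id].
Qed.

Lemma closed_point x : closed [set x].
Proof. exact/accessible_closed_set1/hausdorff_accessible. Qed.

Lemma closed_iter_image R n S :
  closed R -> closed S -> closed (iter n (rel_image R) S).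
Proof. by move=> Rcl Scl; elim: n => //= n; exact: closed_rel_image. Qed.

Definition closed_approx (H : nat -> set (X * X)) R : Prop :=
  [/\ forall k, closed (H k),
      forall j k, (j <= k)%N -> H k `<=` H j
    & \bigcap_k H k `<=` R].

Lemma closed_approx_converse H R : closed_approx H R ->
  closed_approx (fun k => (H k)^-1)%relation (R^-1)%relation.
Proof.
move=> [Hcl Hdec HR]; split=> [k|j k jk xy|xy Hxy].
- exact: closed_converse.
- exact: Hdec.
- by apply: HR => k _; exact: Hxy.
Qed.

(** If [y] is in each image, its preimages along the [H k] form nested nonempty
    closed sets, so one of them is a preimage for every [k]. *)
Lemma approx_iter_image H R n S : closed_approx H R -> closed S ->
  \bigcap_k iter n (rel_image (H k)) S `<=` iter n (rel_image R) S.
Proof.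
move=> [Hcl Hdec HR] Scl; elim: n => [|n IHn] y Hy; first exact: (Hy 0%N I).
pose Q k := iter n (rel_image (H k)) S `&` xsection ((H k)^-1)%relation y.
have [k|j k jk x [nx /xsectionP Hxy]|k|x Qx] := @nested_closed_nonempty Q.
- apply: closedI; first exact: closed_iter_image.
  by apply: closed_xsection; exact: closed_converse.
- split; first by apply: iter_imageS nx => //; exact: Hdec.
  by apply/xsectionP; exact: Hdec Hxy.
- have /= /rel_imageP[x nx Hxy] := Hy k I.
  by exists x; split=> //; apply/xsectionP.
apply/rel_imageP; exists x; first by apply: IHn => k _; have [] := Qx k I.
by apply: HR => k _; have [_ /xsectionP] := Qx k I.
Qed.

(** Long [H k]-orbits can be truncated, so [k] iterations for the [k]-th
    relation bound every fixed number of iterations from above. *)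
Lemma approx_eventual_image H R : closed_approx H R ->
  \bigcap_k iter k (rel_image (H k)) setT `<=` eventual_image R.
Proof.
move=> HR; have [_ Hdec _] := HR; move=> y Hy n _.
apply: (approx_iter_image HR closedT) => k _.
have Hmax := iter_image_setT (leq_maxr k n) (Hy (maxn k n) I).
by apply: iter_imageS Hmax => //; apply: Hdec; exact: leq_maxl.
Qed.

Lemma approx_rel_iter H R n x y : closed_approx H R ->
  (forall k, rel_iter (H k) n (x, y)) -> rel_iter R n (x, y).
Proof.
move=> HR Hxy.
have : rel_image (rel_iter R n) [set x] y.
  rewrite rel_image_iter; apply: (approx_iter_image HR (@closed_point x)) => k _.
  by rewrite -rel_image_iter; apply/rel_imageP; exists x.
by move=> /rel_imageP[_ ->].
Qed.

(** Orbits of bounded length converge to an orbit: one length occurs for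
    infinitely many [k], hence for all [k] by monotonicity.  The induction on
    the bound either finds that the largest length always occurs, or discards
    it. *)
Lemma approx_bounded_orbit H R m x y : closed_approx H R ->
  (forall k, exists n, (1 <= n <= m)%N /\ rel_iter (H k) n (x, y)) ->
  orbit_rel R (x, y).
Proof.
move=> HR; have [_ Hdec _] := HR; elim: m => [|m IHm] Hxy.
  by have [n [/andP[n1 n0] _]] := Hxy 0%N; move: (leq_trans n1 n0).
have [Hm|/existsNP[j nHj]] := pselect (forall k, rel_iter (H k) m.+1 (x, y)).
  by exists m.+1 => //; exact: approx_rel_iter HR Hm.
apply: IHm => k; have [n [/andP[n1 nm] Hn]] := Hxy (maxn j k).
exists n; split; last by apply: rel_iterS Hn; apply: Hdec; exact: leq_maxr.
rewrite n1 /= -ltnS ltn_neqAle nm andbT; apply/eqP => nE.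
by apply: nHj; rewrite -nE; apply: rel_iterS Hn; apply: Hdec; exact: leq_maxl.
Qed.

(** Pseudo-orbits of unbounded length from [x] to [y] put [y] in the images of
    all orders, and [x] in the preimages of all orders. *)
Lemma approx_orbit H R x y : closed_approx H R ->
  (forall k, orbit_rel (H k) (x, y)) ->
  orbit_rel R (x, y) \/
  eventual_image (R^-1)%relation x /\ eventual_image R y.
Proof.
move=> HR Hxy; have [_ Hdec _] := HR.
have [long|/existsNP[j short]] :=
  pselect (forall k, exists2 n, (k <= n)%N & rel_iter (H k) n (x, y)).
  right; split.
    apply: (approx_eventual_image (closed_approx_converse HR)) => k _.
    have [n kn Hn] := long k; apply: (iter_image_setT kn).
    by apply/iter_image_setTP; exists y; apply/rel_iter_conv.
  apply: (approx_eventual_image HR) => k _.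
  have [n kn Hn] := long k; apply: (iter_image_setT kn).
  by apply/iter_image_setTP; exists x.
left; apply: (@approx_bounded_orbit H R j) => // k.
have [n /= n1 Hn] := Hxy (maxn j k); exists n; split.
  rewrite n1 /= leqNgt; apply/negP => jn; apply: short.
  by exists n; [exact: ltnW | apply: rel_iterS Hn; apply: Hdec; exact: leq_maxl].
by apply: rel_iterS Hn; apply: Hdec; exact: leq_maxr.
Qed.

Lemma eventual_image_nbhs R U : closed R -> open U ->
  eventual_image (R^-1)%relation `&` eventual_image R `<=` U ->
  exists n, forall z, (exists x, rel_iter R n (x, z)) ->
    (exists y, rel_iter R n (z, y)) -> U z.
Proof.
move=> Rcl Uop EU.
have [n|m n mn z [zm zp]|z Qz|n nU] := @nested_closed_subset
  (fun n => iter n (rel_image R) setT `&`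
            iter n (rel_image (R^-1)%relation) setT) U _ _ Uop.
- by apply: closedI; apply: closed_iter_image; rewrite //; exact: closed_converse.
- by split; exact: (iter_image_setT mn).
- by apply: EU; split=> n _; have [] := Qz n I.
exists n => z xz [y Rzy]; apply: (nU n (leqnn n)); split.
  exact/iter_image_setTP.
by apply/iter_image_setTP; exists y; apply/rel_iter_conv.
Qed.

(** Halfway along a backward orbit of length [n + n] from a point of the
    eventual image there is a point close to the maximal viable set. *)
Lemma eventual_image_sub R P : closed R -> pos_invariant R P ->
  eventual_image (R^-1)%relation `&` eventual_image R `<=` P° ->
  eventual_image R `<=` P.
Proof.
move=> Rcl PR /(eventual_image_nbhs Rcl (@open_interior _ P))[n nP] y Ey.
have /iter_image_setTP[x /rel_iterD[z Rxz Rzy]] := Ey (n + n)%N I.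
apply: (pos_invariant_iter PR _ Rzy); apply: interior_subset.
by apply: nP; [exists x | exists y].
Qed.

Lemma eventual_preimage_disjoint R P : closed R -> closed P ->
  pos_invariant R P ->
  eventual_image (R^-1)%relation `&` eventual_image R `<=` ~` P ->
  eventual_image (R^-1)%relation `&` P = set0.
Proof.
move=> Rcl Pcl PR /(eventual_image_nbhs Rcl (closed_openC Pcl))[n nP].
apply/seteqP; split=> // x [Ex Px].
have /iter_image_setTP[y /rel_iter_conv/rel_iterD[z Rxz Rzy]] := Ex (n + n)%N I.
apply: (nP z); [by exists x | by exists y | exact: pos_invariant_iter PR Px Rxz].
Qed.

End CompactSpace.

(** * Chains and trapping sets in a compact metric space *)

Section CompactMetric.
Context {K : realType} {X : metricType K}.
Implicit Types (R : set (X * X)) (S P U : set X) (x y : X).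

Lemma V_ballE (e : K) x y : V_ e (x, y) <-> ball x e y.
Proof. by rewrite ballEmdist. Qed.

(** Taking the closure of the composite, rather than composing with a closed
    ball relation, makes it closed by construction. *)
Definition thickening R (k : nat) : set (X * X) :=
  closure (V_ (k.+1%:R^-1 : K) \; R)%relation.

Lemma thickening_approx R : closed R -> closed_approx (thickening R) R.
Proof.
move=> Rcl; split=> [k|j k jk|[x y] Rxy].
- exact: closed_closure.
- apply: closureS => -[x y] [z /= Rxz zy]; exists z => //=.
  apply/V_ballE; apply: le_ball; last exact/V_ballE/zy.
  by rewrite lef_pV2 ?posrE ?ltr0n// ler_nat ltnS.
rewrite [R](closure_id R).1// => B [[B1 B2] /= [B1x B2y] B12].
have /nbhs_ballP[e e0 eB2] := B2y.
have e20 : 0 < e / 2 by rewrite divr_gt0.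
have [k _ /(_ k (leqnn k)) ke] := near_infty_natSinv_lt (PosNum e20).
have yB : nbhs (x, y) (B1 `*` ball y (e / 2)).
  by exists (B1, ball y (e / 2)) => //; split=> //; exact: nbhsx_ballx.
have [[x' y'] [[z /= Rx'z zy'] [/= B1x' yy']]] := Rxy k I _ yB.
exists (x', z); split=> //; apply: B12; split=> //=; apply: eB2.
rewrite [e]splitr; apply: ball_triangle yy' _; apply/ball_sym.
apply: (le_ball (ltW ke)); exact/V_ballE.
Qed.

Hypothesis X_compact : compact [set: X].

Lemma chain_rel_dichotomy R x y : closed R -> chain_rel (K := K) R (x, y) ->
  orbit_rel R (x, y) \/
  eventual_image (R^-1)%relation x /\ eventual_image R y.
Proof.
move=> Rcl Rxy.
apply: (approx_orbit X_compact (@metric_hausdorff K X) (thickening_approx Rcl)) => k.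
have k0 : 0 < (k.+1%:R^-1 : K) by rewrite invr_gt0.
have [n n1 Rn] := Rxy _ k0; exists n => //.
by apply: rel_iterS Rn; exact: subset_closure.
Qed.

Lemma chain_rel_invariant R P : closed R -> pos_invariant R P ->
  eventual_image R `<=` P \/ eventual_image (R^-1)%relation `&` P = set0 ->
  pos_invariant (chain_rel (K := K) R) P.
Proof.
move=> Rcl PR EP y /rel_imageP[x Px /(chain_rel_dichotomy Rcl)].
move=> [[n _ Rn]|[Ex Ey]]; first exact: pos_invariant_iter PR Px Rn.
by case: EP => [|E0]; [exact | have : set0 x by rewrite -E0].
Qed.

(** The sets are the iterated images of the whole space under the thickenings of
    [R].  Applying a thickening again both keeps the image inside and swallows
    a ball around each point of the image under [R]. *)
Lemma trapping_sets R : closed R -> exists Q : nat -> set X,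
  [/\ forall k, closed (Q k),
      forall j k, (j <= k)%N -> Q k `<=` Q j,
      \bigcap_k Q k `<=` eventual_image R,
      forall k, rel_image R (Q k) `<=` (Q k)°
    & forall k A, A `<=` rel_image R A -> A `<=` Q k].
Proof.
move=> Rcl; have TR := thickening_approx Rcl; have [Tcl Tdec _] := TR.
have RT k : R `<=` thickening R k.
  move=> [x y] Rxy; apply: subset_closure; exists y => //=.
  by apply/V_ballE; apply: ballxx; rewrite invr_gt0.
exists (fun k => iter k (rel_image (thickening R k)) setT); split.
- by move=> k; apply: closed_iter_image => //; exact: metric_hausdorff.
- move=> j k jk; apply: subset_trans (iter_image_setT jk) _.
  by apply: iter_imageS => //; exact: Tdec.
- exact: (approx_eventual_image X_compact (@metric_hausdorff K X) TR).
- move=> k y /rel_imageP[x Qx Rxy].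
  apply/nbhs_ballP; exists k.+1%:R^-1; first by rewrite /= invr_gt0.
  move=> z yz; apply: (iter_image_setT (leqnSn k)).
  apply/rel_imageP; exists x => //; apply: subset_closure.
  by exists y => //=; apply/V_ballE.
- move=> k A AR; suff: forall n, A `<=` iter n (rel_image (thickening R k)) setT.
    exact.
  elim=> [//|n IHn]; apply: subset_trans AR _ => /=.
  exact: rel_imageS.
Qed.

End CompactMetric.

(** * Index pairs *)

Section IndexPairs.
Context {X : topologicalType}.
Hypotheses (X_compact : compact [set: X]) (X_hausdorff : hausdorff_space X).
Variable F : set (X * X).
Hypothesis F_closed : closed F.
Implicit Types (A C P Q R : set X).

Lemma closed_rel_restr C : closed C -> closed (rel_restr F C).
Proof.
move=> Ccl; apply: closedI => //.
have -> : C `*` C = (@fst X X @^-1` C) `&` (@snd X X @^-1` C) by [].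
by apply: closedI; [exact: closed_fst_preimage | exact: closed_snd_preimage].
Qed.

(** Since [F(P)] is closed, a point of [C] in the closure of [F(P) \ P] is the
    image of a point of [P] within [C]; and near it, [F] leaves [P] only by
    leaving [C]. *)
Lemma setI_rho_boundary C P : closed P -> P `<=` C ->
  pos_invariant (rel_restr F C) P ->
  C `&` rho F P `<=` P `&` boundary C.
Proof.
move=> Pcl PC PR y [Cy rhoy].
have /rel_imageP[x Px Fxy] : rel_image F P y.
  have -> : rel_image F P = closure (rel_image F P).
    exact/closure_id/closed_rel_image.
  by apply: closureS rhoy; exact: subDsetl.
split; first by apply/PR/rel_imageP; exists x => //; split=> //; split=> //; exact: PC.
split=> // Cy'; have [z [[/rel_imageP[w Pw Fwz] nPz] Cz]] := rhoy _ Cy'.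
by apply/nPz/PR/rel_imageP; exists w => //; split=> //; split=> //; exact: PC.
Qed.

(** As [Q /\ R] is interior to [C], a boundary point of it is on the boundary of
    [Q] or of [R].  On the boundary of [Q] it cannot be the image within [C] of a
    point of [Q], and on that of [R] it cannot be the preimage within [C] of a
    point of [R]. *)
Lemma simple_trapping_intersection C Q R : closed Q -> closed R ->
  Q `&` R `<=` C° ->
  rel_image (rel_restr F C) Q `<=` Q° ->
  rel_image ((rel_restr F C)^-1)%relation R `<=` R° ->
  simple_isolating_nbhd F (Q `&` R).
Proof.
move=> Qcl Rcl QRC FQ FR; split; first exact: closedI.
have QRC' x : (Q `&` R) x -> C x by move=> /QRC; exact: interior_subset.
move=> x [QRx nQRx]; have [Rx|nRx] := pselect (R° x).
  right; apply/seteqP; split=> // y [/xsectionP Fyx QRy]; apply: nQRx.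
  rewrite interiorI; split=> //; apply/FQ/rel_imageP; exists y; first by case: QRy.
  by split=> //; split=> /=; exact: QRC'.
left; apply/seteqP; split=> // y [/xsectionP Fxy QRy]; apply: nRx.
apply/FR/rel_imageP; exists y; first by case: QRy.
by split=> //; split=> /=; exact: QRC'.
Qed.

(** The exit set must be closed, so the interior of [R] is removed rather than
    [R]; strict trapping of [R] by the converse relation makes this exit set
    invariant, since a preimage within [C] of a point of [R] is in the interior of
    [R]. *)
Lemma trapping_index_pair C A Q R : isolating_nbhd F C A ->
  closed Q -> Q `&` R `<=` C° ->
  rel_image (rel_restr F C) Q `<=` Q° ->
  rel_image ((rel_restr F C)^-1)%relation R `<=` R° ->
  A `<=` Q° `&` R° ->
  index_pair F C A (Q `&` C) ((Q `&` C) `\` R°).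
Proof.
move=> iso Qcl QRC FQ FR AQR; have [Ccl AE AC] := iso.
have P1inv : pos_invariant (rel_restr F C) (Q `&` C).
  move=> y /rel_imageP[x [Qx _] Fxy]; split; last by case: Fxy => _ [].
  by apply: interior_subset; apply/FQ/rel_imageP; exists x.
split=> //; split.
- split; first exact: closedI.
  rewrite setDE; apply: closedI; first exact: closedI.
  exact/open_closedC/open_interior.
- by split; [exact: subDsetl | exact: subIsetr].
- split=> // y /rel_imageP[x [P1x nRx] Fxy]; split.
    by apply/P1inv/rel_imageP; exists x.
  move=> /interior_subset Ry; apply/nRx/FR/rel_imageP; by exists y.
- move=> x Ax; have [Qx Rx] := AQR x Ax; split; last by case.
  by rewrite interiorI; split=> //; apply: AC; rewrite -AE.
- move=> x [P1x nP2x]; apply: QRC; split; first by case: P1x.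
  by apply: interior_subset; apply: contrapT => nRx; apply: nP2x.
Qed.

End IndexPairs.

Theorem theorem2p39 (K : realType) (X : metricType K)
    (F : set (X * X)) (C A : set X)
    (X_compact : compact [set: X]) (F_closed : closed F)
    (A_viable : viable F A) (C_isolating : isolating_nbhd F C A) :
  (forall P1 P2 : set X, index_pair F C A P1 P2 ->
     [/\ pos_invariant (chain_rel (rel_restr F C)) P1,
         pos_invariant (chain_rel (rel_restr F C)) P2,
         inv_minus F C `<=` P1
       & inv_plus F C `&` P2 = set0]
     /\
     [/\ C `&` rho F P1 = delta F P1,
         delta F P1 `<=` P1 `&` boundary C
       & P1 `&` boundary C `<=` P2])
  /\
  (forall U V : set X, open U -> open V ->
     inv_minus F C `<=` U -> inv_pm F C `<=` V -> V `<=` C ->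
     exists C0 P1 P2 : set X,
       [/\ simple_isolating_nbhd F C0,
           index_pair F C A P1 P2,
           P1 `<=` U,
           closure (P1 `\` P2) `<=` C0 /\ C0 `<=` V
         & closure (P1 `\` P2) `<=` C°]).
Proof.
have X_hausdorff : hausdorff_space X := @metric_hausdorff K X.
have [C_closed AE AC] := C_isolating.
have f_closed : closed (rel_restr F C) by exact: closed_rel_restr.
set f := rel_restr F C in f_closed *.
have pmE : inv_pm F C =
    eventual_image (f^-1)%relation `&` eventual_image f.
  by rewrite /inv_pm inv_minusE inv_plusE.
split=> [P1 P2 [_ [[P1cl P2cl] [P21 P1C] [P1f P2f] AP PC]]|].
  have minusP1 : eventual_image f `<=` P1.
    apply: (eventual_image_sub X_compact X_hausdorff) => //.
    by rewrite -pmE -AE => x /AP[].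
  have plusP2 : eventual_image (f^-1)%relation `&` P2 = set0.
    apply: (eventual_preimage_disjoint X_compact X_hausdorff) => //.
    by rewrite -pmE -AE => x /AP[].
  have rhoP1 : C `&` rho F P1 `<=` P1 `&` boundary C.
    exact: (setI_rho_boundary X_compact X_hausdorff).
  split; split.
  - by apply: chain_rel_invariant => //; left.
  - by apply: chain_rel_invariant => //; right.
  - by rewrite inv_minusE.
  - by rewrite inv_plusE.
  - apply/seteqP; split=> [x Cx|x [/P1C]//]; split; last by case: Cx.
    by have [] := rhoP1 x Cx.
  - by move=> x [/P1C Cx rhox]; exact: rhoP1.
  - by move=> x [P1x [_ nCx]]; apply: contrapT => nP2x; apply/nCx/PC.
move=> U V Uop Vop minusU pmV VC.
have VC0 : V `<=` C° by rewrite -open_subsetE.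
have [Q [Qcl Qdec QE Qf Qmax]] := trapping_sets X_compact f_closed.
have [R [Rcl Rdec RE Rf Rmax]] :=
  trapping_sets X_compact (closed_converse f_closed).
have [|k1 QU] := nested_closed_subset X_compact Qcl Qdec Uop.
  by apply: subset_trans QE _; rewrite -inv_minusE.
have [k|j k jk x [Qx Rx]|x QRx|k2 QRV] :=
    @nested_closed_subset X X_compact (fun k => Q k `&` R k) V _ _ Vop.
- exact: closedI.
- by split; [exact: Qdec Qx | exact: Rdec Rx].
- apply: pmV; rewrite pmE; split.
    by apply: RE => k _; have [] := QRx k I.
  by apply: QE => k _; have [] := QRx k I.
pose k := maxn k1 k2.
have {}QU : Q k `<=` U by apply: QU; exact: leq_maxl.
have {}QRV : Q k `&` R k `<=` V by apply: QRV; exact: leq_maxr.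
have A_C x : A x -> C x by rewrite AE => /AC; exact: interior_subset.
have [_ AF] := A_viable.
have Af : A `<=` rel_image f A.
  move=> y Ay; have [/rel_imageP[x Ax Fxy] _] := AF y Ay; apply/rel_imageP.
  by exists x => //; split=> //; split; exact: A_C.
have Af' : A `<=` rel_image (f^-1)%relation A.
  move=> y Ay; have [_ /rel_imageP[x Ax Fyx]] := AF y Ay; apply/rel_imageP.
  by exists x => //; split=> //; split; exact: A_C.
have AQR : A `<=` (Q k)° `&` (R k)°.
  move=> x Ax; split.
    by apply: Qf; apply: rel_imageS (Af x Ax) => //; exact: Qmax.
  by apply: Rf; apply: rel_imageS (Af' x Ax) => //; exact: Rmax.
have P12 : closure ((Q k `&` C) `\` ((Q k `&` C) `\` (R k)°)) `<=` Q k `&` R k.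
  rewrite [X in _ `<=` X](closure_id _).1; last exact: closedI.
  apply: closureS => x [[Qx Cx] nP2x]; split=> //.
  by apply: interior_subset; apply: contrapT => nRx; apply: nP2x.
exists (Q k `&` R k), (Q k `&` C), ((Q k `&` C) `\` (R k)°); split=> //.
- apply: (@simple_trapping_intersection _ F C) => //.
  exact: subset_trans QRV VC0.
- apply: trapping_index_pair => //; exact: subset_trans QRV VC0.
- by move=> x [/QU].
- exact: subset_trans P12 (subset_trans QRV VC0).
Qed.
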